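(* Suppose that $f:G\to G'$ is an arbitrary homomorphism between finite groups. Then: (1) the adjunction $\mathrm{res}_f:\mathbf{Op}^{G'}_+\rightleftarrows\mathbf{Op}^G_+:\mathrm{coind}_f$ is a Quillen adjunction; (2) the adjunction $\mathrm{ind}_f:\mathbf{Op}^G_+\rightleftarrows\mathbf{Op}^{G'}_+:\mathrm{res}_f$ is a Quillen adjunction if and only if the homomorphism $f$ is injective.
   Context: For a finite group $G$, $\mathbf{Op}^G_+$ is the category of marked $G$-operads: symmetric operads $\mathscr{O}$ in left $G$-sets together with chosen elements $u\in\mathscr{O}(0)^G$ and $p\in\mathscr{O}(2)^G$; morphisms are operad maps preserving the markings. $\mathscr{O}(n)$ is regarded as a left $G\times\Sigma_n$-set via $(g,\sigma)\cdot x=gx\sigma^{-1}$. A graph subgroup of $G\times\Sigma_n$ is one of the form $\{(h,\sigma(h))\mid h\in H\}$ with $H\subset G$ a subgroup and $\sigma:H\to\Sigma_n$ a homomorphism. Let $F_+$ be the left adjoint of the forgetful functor from $\mathbf{Op}^G_+$ to symmetric sequences of $G$-sets. $\mathbf{Op}^G_+$ carries a cofibrantly generated model structure in which a morphism $\mathscr{O}\to\mathscr{P}$ is a weak equivalence iff for all $n\ge0$ and graph subgroups $\Gamma\subset G\times\Sigma_n$, $\mathscr{P}(n)^\Gamma\neq\varnothing$ implies $\mathscr{O}(n)^\Gamma\ne\varnothing$; the generating cofibrations are $F_+(\varnothing\to(G\times\Sigma_n)/\Gamma)$ and the generating acyclic cofibrations are $F_+$ of the inclusions $(G\times\Sigma_n)/\Gamma\to(G\times\Sigma_n)/\Gamma\sqcup(G\times\Sigma_n)/\Gamma$,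 for $n\ge0$ and graph subgroups $\Gamma\subset G\times\Sigma_n$ (orbits being symmetric sequences concentrated in arity $n$). Every object is fibrant, and every cofibrant operad is $\Sigma$-free with $G$-fixed operations of all arities. Writing $BG$ for the one-object category with morphisms $G$ and $\mathbf{Op}_+$ for marked operads in sets, $\mathbf{Op}^G_+\cong\mathrm{Fun}(BG,\mathbf{Op}_+)$. For $f:G\to G'$, $\mathrm{res}_f$ is pullback along $Bf:BG\to BG'$, and $\mathrm{ind}_f$ and $\mathrm{coind}_f$ are left and right Kan extension along $Bf$. *)

(* Defs.v *)
From mathcomp Require Import all_boot all_order all_fingroup.
From mathcomp Require Import boolp.

Set Implicit Arguments.
Unset Strict Implicit.
Unset Printing Implicit Defensive.

Local Open Scope group_scope.

Record category := Category {
  ob :> Type;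
  hom : ob -> ob -> Type;
  idm : forall x, hom x x;
  compm : forall x y z, hom y z -> hom x y -> hom x z;
  compm1 : forall x y (f : hom x y), compm f (idm x) = f;
  comp1m : forall x y (f : hom x y), compm (idm y) f = f;
  compmA : forall w x y z (h : hom y z) (g : hom x y) (f : hom w x),
    compm h (compm g f) = compm (compm h g) f
}.
Arguments hom {c}.
Arguments idm {c}.

Record functor (C D : category) := Functor {
  fob :> C -> D;
  fmap : forall x y, hom x y -> hom (fob x) (fob y);
  fmap1 : forall x, fmap (idm x) = idm (fob x);
  fmapM : forall x y z (g : hom y z) (f : hom x y),
    fmap (compm g f) = compm (fmap g) (fmap f)
}.
Arguments fmap {C D} f0 {x y}.

Record adjunction (C D : category) (L : functor C D) (R : functor D C) :=
  Adjunction {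
  transpose : forall c d, hom (L c) d -> hom c (R d);
  untranspose : forall c d, hom c (R d) -> hom (L c) d;
  transposeK : forall c d, cancel (@transpose c d) (@untranspose c d);
  untransposeK : forall c d, cancel (@untranspose c d) (@transpose c d);
  transpose_nat : forall c c' d d' (g : hom c' c) (k : hom d d') (h : hom (L c) d),
    transpose (compm k (compm h (fmap L g)))
    = compm (fmap R k) (compm (transpose h) g)
}.

Definition arrow_class (C : category) := forall x y : C, hom x y -> Prop.

Definition has_lift (C : category) (a b x y : C) (i : hom a b) (p : hom x y) :=
  forall (u : hom a x) (v : hom b y), compm p u = compm v i ->
    exists2 l : hom b x, compm l i = u & compm p l = v.

Definition rlp (C : category) (K : arrow_class C) : arrow_class C :=
  fun x y p => forall (a b : C) (i : hom a b), K a b i -> has_lift i p.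

Definition llp (C : category) (K : arrow_class C) : arrow_class C :=
  fun a b i => forall (x y : C) (p : hom x y), K x y p -> has_lift i p.

(* Only the three classes are recorded: the model category axioms play no role
   in saying that an adjunction is Quillen. *)
Record model_data (C : category) := ModelData {
  weq : arrow_class C;
  cof : arrow_class C;
  fib : arrow_class C
}.

Definition cofibrantly_generated (C : category) (W I J : arrow_class C) :=
  {| weq := W; cof := llp (rlp I); fib := rlp J |}.

Definition Quillen_adjunction (C D : category) (MC : model_data C)
    (MD : model_data D) (L : functor C D) (R : functor D C)
    (A : adjunction L R) : Prop :=
  (forall (x y : C) (i : hom x y), cof MC i -> cof MD (fmap L i)) /\
  (forall (x y : C) (i : hom x y), cof MC i -> weq MC i ->
     cof MD (fmap L i) /\ weq MD (fmap L i)).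

Section UniversalArrows.
Variables (C D : category) (R : functor D C) (L0 : C -> D).
Variable eta : forall c, hom c (R (L0 c)).
Variable lift : forall c d, hom c (R d) -> hom (L0 c) d.
Hypothesis lift_eta : forall c d (h : hom c (R d)),
  compm (fmap R (lift h)) (eta c) = h.
Hypothesis lift_uniq : forall c d (k : hom (L0 c) d),
  lift (compm (fmap R k) (eta c)) = k.

Lemma univ_inj c d (k k' : hom (L0 c) d) :
  compm (fmap R k) (eta c) = compm (fmap R k') (eta c) -> k = k'.
Proof. by move=> e; rewrite -(lift_uniq k) e lift_uniq. Qed.

Definition univ_fmap c c' (g : hom c c') : hom (L0 c) (L0 c') :=
  lift (compm (eta c') g).

Lemma univ_fmap1 c : univ_fmap (idm c) = idm (L0 c).
Proof. by apply: univ_inj; rewrite lift_eta fmap1 compm1 comp1m. Qed.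

Lemma univ_fmapM c c' c'' (g : hom c' c'') (f : hom c c') :
  univ_fmap (compm g f) = compm (univ_fmap g) (univ_fmap f).
Proof.
by apply: univ_inj; rewrite lift_eta fmapM -compmA lift_eta !compmA lift_eta.
Qed.

Definition univ_functor : functor C D := Functor univ_fmap1 univ_fmapM.

Definition univ_transpose c d (k : hom (univ_functor c) d) : hom c (R d) :=
  compm (fmap R k) (eta c).

Lemma univ_transpose_nat c c' d d' (g : hom c' c) (k : hom d d')
    (h : hom (univ_functor c) d) :
  univ_transpose (compm k (compm h (fmap univ_functor g)))
  = compm (fmap R k) (compm (univ_transpose h) g).
Proof. by rewrite /univ_transpose !fmapM -!compmA lift_eta. Qed.

Definition univ_adjunction : adjunction univ_functor R :=
  @Adjunction C D univ_functor R univ_transpose lift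
    (fun c d => @lift_uniq c d) (fun c d => @lift_eta c d) univ_transpose_nat.
End UniversalArrows.

(* The product of ['S_n] is that of MathComp, [(s * t) i = t (s i)]; the law
   [sactM] is a right action for this product.  On actual operations it reads
   [(sact x s)(a_0, a_1, ...) = x(a_(s 0), a_(s 1), ...)].  The convention that
   composes permutations from right to left is recovered by [s |-> s^-1], which
   identifies the two notions of graph subgroup and their fixed points. *)
Record symseq (G : finGroupType) := SymSeq {
  ops :> nat -> Type;
  gact : forall n, G -> ops n -> ops n;
  sact : forall n, ops n -> 'S_n -> ops n;
  gact1 : forall n (x : ops n), gact 1 x = x;
  gactM : forall n g h (x : ops n), gact (g * h) x = gact g (gact h x);
  sact1 : forall n (x : ops n), sact x 1 = x;
  sactM : forall n (x : ops n) s t, sact x (s * t) = sact (sact x s) t;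
  gsactC : forall n g (x : ops n) s, gact g (sact x s) = sact (gact g x) s
}.
Arguments gact {G S n} g x : rename.
Arguments sact {G S n} x s : rename.

Definition GSym (G : finGroupType) (n : nat) : finGroupType := (G * 'S_n)%type.

Definition prodact (G : finGroupType) (S : symseq G) n (a : GSym G n) (x : S n)
  : S n := gact a.1 (sact x a.2^-1).

Definition fixed_by (G : finGroupType) (S : symseq G) n
    (K : {group GSym G n}) (x : S n) : Prop :=
  forall a, a \in K -> prodact a x = x.

Definition graph_subgroup (G : finGroupType) n (K : {group GSym G n}) : Prop :=
  exists (H : {group G}) (s : {morphism H >-> 'S_n}),
    K :=: [set (h, s h) | h in H].

Section SymSeq.
Variable G : finGroupType.

Definition is_seqmap (S T : symseq G) (f : forall n, S n -> T n) : Prop :=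
  (forall n g (x : S n), f n (gact g x) = gact g (f n x)) /\
  (forall n (x : S n) s, f n (sact x s) = sact (f n x) s).

Record seqmap (S T : symseq G) := SeqMap {
  seqfun :> forall n, S n -> T n;
  seqfunP : is_seqmap seqfun
}.

Lemma seqmap_eq (S T : symseq G) (f g : seqmap S T) :
  (forall n x, f n x = g n x) -> f = g.
Proof.
case: f g => [f fP] [g gP] /= e.
have {}e : f = g by apply: functional_extensionality_dep => n; apply/funext/e.
by rewrite e in fP *; rewrite (Prop_irrelevance fP gP).
Qed.

Lemma is_seqmap_id (S : symseq G) : is_seqmap (fun n (x : S n) => x).
Proof. by []. Qed.

Lemma is_seqmap_comp (S T U : symseq G) (g : seqmap T U) (f : seqmap S T) :
  is_seqmap (fun n x => g n (f n x)).
Proof.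
case: g f => [g [g1 g2]] [f [f1 f2]] /=.
by split=> n *; rewrite ?f1 ?g1 ?f2 ?g2.
Qed.

Definition SymSeqCat : category.
Proof.
by refine (@Category (symseq G) seqmap (fun S => SeqMap (@is_seqmap_id S))
  (fun S T U g f => SeqMap (is_seqmap_comp g f)) _ _ _) => *; apply: seqmap_eq.
Defined.

Definition empty_seq : symseq G.
Proof.
by exact: (@SymSeq G (fun=> void) (fun _ _ x => x) (fun _ x _ => x)
  (fun _ => fun=> erefl) (fun _ _ _ => fun=> erefl) (fun _ => fun=> erefl)
  (fun _ _ _ => fun=> erefl) (fun _ _ _ => fun=> erefl)).
Defined.

Lemma is_seqmap_from_empty (S : symseq G) :
  @is_seqmap empty_seq S (fun n => @of_void _).
Proof. by split=> n; [move=> g | ]; case. Qed.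

Definition from_empty (S : SymSeqCat) : hom (empty_seq : SymSeqCat) S :=
  SeqMap (is_seqmap_from_empty S).

Definition sum_seq (S T : symseq G) : symseq G.
Proof.
refine (@SymSeq G (fun n => S n + T n)%type
  (fun n g x => match x with inl y => inl (gact g y) | inr y => inr (gact g y) end)
  (fun n x s => match x with inl y => inl (sact y s) | inr y => inr (sact y s) end)
  _ _ _ _ _).
- by move=> n [] x; rewrite gact1.
- by move=> n g h [] x; rewrite gactM.
- by move=> n [] x; rewrite sact1.
- by move=> n [] x *; rewrite sactM.
- by move=> n g [] x s; rewrite gsactC.
Defined.

Lemma is_seqmap_inl (S T : symseq G) :
  @is_seqmap S (sum_seq S T) (fun n => @inl _ _).
Proof. by []. Qed.

Definition inl_seq (S T : SymSeqCat) : hom S (sum_seq S T : SymSeqCat) :=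
  SeqMap (@is_seqmap_inl S T).

(* Arity [m] of the orbit is empty unless [m = n], where it is the set of left
   cosets of [K]. *)
Section Orbit.
Variables (n : nat) (K : {group GSym G n}).

Definition orbit_ops (m : nat) : Type :=
  {C : {set GSym G n} | (m == n) && (C \in lcosets K [set: GSym G n])}.

Lemma orbit_arity m (c : orbit_ops m) : m = n.
Proof. by case: c => C /andP[/eqP]. Qed.

Lemma orbit_mulP m (a : GSym G n) (c : orbit_ops m) :
  (m == n) && ((a *: val c)%g \in lcosets K [set: GSym G n]).
Proof.
case: c => C /= /andP[-> /lcosetsP[b _ ->]] /=.
by apply/lcosetsP; exists (a * b); rewrite ?inE ?lcosetM.
Qed.

Definition orbit_mul m a (c : orbit_ops m) : orbit_ops m :=
  exist _ (a *: val c)%g (orbit_mulP a c).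

Definition orbit_seq : symseq G.
Proof.
refine (@SymSeq G orbit_ops
  (fun m g c => orbit_mul (g, 1) c)
  (fun m c s => orbit_mul (1, (cast_perm (orbit_arity c) s)^-1) c) _ _ _ _ _).
- by move=> m x; apply: val_inj; rewrite /= lcoset1.
- move=> m g h x; apply: val_inj; rewrite /= -lcosetM.
  by congr (_ *: _); congr (_, _); rewrite mulg1.
- move=> m x; apply: val_inj; rewrite /=.
  have -> : cast_perm (orbit_arity x) 1 = 1.
    by apply/permP=> i; rewrite cast_permE !perm1 cast_ordKV.
  by rewrite invg1 lcoset1.
- move=> m x s t; apply: val_inj; rewrite /= -lcosetM.
  rewrite (Prop_irrelevance (orbit_arity (orbit_mul _ _)) (orbit_arity x)).
  congr (_ *: _); congr (_, _); rewrite ?mulg1 //= -invMg; congr (_^-1).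
  by apply/permP=> i; rewrite permM !cast_permE permM !cast_ordK.
- move=> m g x s; apply: val_inj; rewrite /= -!lcosetM.
  rewrite (Prop_irrelevance (orbit_arity (orbit_mul _ _)) (orbit_arity x)).
  by congr (_ *: _); congr (_, _); rewrite ?mulg1 ?mul1g.
Defined.
End Orbit.
End SymSeq.

Lemma Tagged_inj (I : eqType) (T : I -> Type) (i : I) : injective (@Tagged I i T).
Proof.
by move=> x y /(congr1 (tagged_as (Tagged T x))); rewrite !tagged_asE.
Qed.

(* [tagnat] enumerates [{i : 'I_k & 'I_(j i)}] lexicographically by the inputs
   of a composite [gamma(x; y_0, y_1, ...)] with [x] of arity [k] and [y_i] of
   arity [j i]: input [l] of [y_i] is number [tagnat.Rank i l]. *)
Section BlockPermutations.
Variables (k : nat) (j : 'I_k -> nat).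

Lemma perm_blocks_inj (t : forall i, 'S_(j i)) :
  injective (fun a : 'I_(\sum_i j i) =>
    @tagnat.Rank k j (tagnat.sig1 a) (t _ (tagnat.sig2 a))).
Proof.
move=> a b /tagnat.rank_inj e; apply: tagnat.sig_inj; move: e.
rewrite !tagnat.sigE12; move: (tagnat.sig2 a) (tagnat.sig2 b).
move: (tagnat.sig1 a) (tagnat.sig1 b) => i i' l l' e.
have ei : i = i' := congr1 tag e; case: _ / ei in l' e *.
by have /perm_inj -> := Tagged_inj e.
Qed.

(* Block sum: [(i, l) |-> (i, t i l)]. *)
Definition perm_blocks (t : forall i, 'S_(j i)) : 'S_(\sum_i j i) :=
  perm (@perm_blocks_inj t).

Lemma block_perm_arity (s : 'S_k) : (\sum_i j i = \sum_i j (s i))%N.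
Proof. exact: reindex_inj (@perm_inj _ s). Qed.

Lemma block_perm_inj (s : 'S_k) :
  injective (fun a : 'I_(\sum_i j (s i)) =>
    cast_ord (block_perm_arity s)
      (@tagnat.Rank k j (s (tagnat.sig1 a)) (tagnat.sig2 a))).
Proof.
move=> a b /cast_ord_inj/tagnat.rank_inj e; apply: tagnat.sig_inj; move: e.
rewrite !tagnat.sigE12; move: (tagnat.sig2 a) (tagnat.sig2 b).
move: (tagnat.sig1 a) (tagnat.sig1 b) => i i' l l' e.
have ei : i = i' := perm_inj (congr1 tag e); case: _ / ei in l' e *.
by have -> := Tagged_inj e.
Qed.

(* Block permutation: [(i, l) |-> (s i, l)]. *)
Definition block_perm (s : 'S_k) : 'S_(\sum_i j (s i)) :=
  perm (@block_perm_inj s).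
End BlockPermutations.

(* A symmetric operad in left [G]-sets with marked fixed operations [mark_u]
   and [mark_p].  Operations whose arities agree only propositionally are
   compared in the total space [{n & O n}]. *)
Record operad (G : finGroupType) := Operad {
  opseq :> symseq G;
  opid : opseq 1%N;
  gamma : forall k (j : 'I_k -> nat),
    opseq k -> (forall i, opseq (j i)) -> opseq (\sum_i j i)%N;
  mark_u : opseq 0%N;
  mark_p : opseq 2%N;
  gact_id : forall g, gact g opid = opid;
  gact_u : forall g, gact g mark_u = mark_u;
  gact_p : forall g, gact g mark_p = mark_p;
  gact_gamma : forall g k (j : 'I_k -> nat) x (y : forall i, opseq (j i)),
    gact g (gamma x y) = gamma (gact g x) (fun i => gact g (y i));
  gamma1x : forall n (x : opseq n),
    Tagged opseq (gamma opid (fun _ : 'I_1 => x)) = Tagged opseq x;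
  gammax1 : forall n (x : opseq n),
    Tagged opseq (gamma x (fun _ : 'I_n => opid)) = Tagged opseq x;
  gammaA : forall k (j : 'I_k -> nat) x (y : forall i, opseq (j i))
      (m : 'I_(\sum_i j i)%N -> nat) (z : forall a, opseq (m a)),
    Tagged opseq (gamma (gamma x y) z)
    = Tagged opseq
        (gamma x (fun i => gamma (y i) (fun l => z (@tagnat.Rank k j i l))));
  gamma_sact_in : forall k (j : 'I_k -> nat) x (y : forall i, opseq (j i))
      (t : forall i, 'S_(j i)),
    gamma x (fun i => sact (y i) (t i)) = sact (gamma x y) (perm_blocks t);
  gamma_sact_out : forall k (j : 'I_k -> nat) x (y : forall i, opseq (j i))
      (s : 'S_k),
    Tagged opseq (gamma (sact x s) y)
    = Tagged opseq (sact (gamma x (fun i => y (s i))) (block_perm j s))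
}.
Arguments opid {G} o.
Arguments gamma {G} o {k j}.
Arguments mark_u {G} o.
Arguments mark_p {G} o.

Lemma eq_gamma (G : finGroupType) (O : operad G) k (j : 'I_k -> nat) (x : O k)
    (y y' : forall i, O (j i)) :
  (forall i, y i = y' i) -> gamma O x y = gamma O x y'.
Proof. by move=> e; congr gamma; apply: functional_extensionality_dep. Qed.

Section Operads.
Variable G : finGroupType.

Record is_opmap (O P : operad G) (f : seqmap O P) : Prop := IsOpmap {
  opmap_id : f 1%N (opid O) = opid P;
  opmap_gamma : forall k (j : 'I_k -> nat) (x : O k) (y : forall i, O (j i)),
    f _ (gamma O x y) = gamma P (f _ x) (fun i => f _ (y i));
  opmap_u : f 0%N (mark_u O) = mark_u P;
  opmap_p : f 2%N (mark_p O) = mark_p P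
}.

Record opmap (O P : operad G) := OpMap {
  opmap_seq :> seqmap O P;
  opmapP : is_opmap opmap_seq
}.

Lemma opmap_eq (O P : operad G) (f g : opmap O P) :
  (forall n x, f n x = g n x) -> f = g.
Proof.
case: f g => [f fP] [g gP] /= /seqmap_eq e.
by rewrite e in fP *; rewrite (Prop_irrelevance fP gP).
Qed.

Lemma is_opmap_id (O : operad G) : @is_opmap O O (idm (O : SymSeqCat G)).
Proof. by split. Qed.

Lemma is_opmap_comp (O P Q : operad G) (g : opmap P Q) (f : opmap O P) :
  is_opmap (compm (c := SymSeqCat G) (opmap_seq g) (opmap_seq f)).
Proof.
case: g f => [g [g1 g2 g3 g4]] [f [f1 f2 f3 f4]].
by split; rewrite /= ?f1 ?f3 ?f4 //= => k j x y; rewrite f2 g2.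
Qed.

Definition OpCat : category.
Proof.
by refine (@Category (operad G) opmap (fun O => OpMap (@is_opmap_id O))
  (fun O P Q g f => OpMap (is_opmap_comp g f)) _ _ _) => *; apply: opmap_eq.
Defined.

Definition forget : functor OpCat (SymSeqCat G).
Proof.
by exact: (@Functor OpCat (SymSeqCat G) (fun O => opseq O)
  (fun O P f => opmap_seq f) (fun _ => erefl) (fun _ _ _ _ _ => erefl)).
Defined.
End Operads.

(* Formal expressions in generators [X], identified when they agree under all
   admissible ([V]) interpretations of the generators in marked G-operads. *)
Section Generated.
Variables (G : finGroupType) (X : nat -> Type).
Variable V : forall P : operad G, (forall n, X n -> P n) -> Prop.

Inductive term : nat -> Type :=
| tgen n : X n -> term n
| tid : term 1%N
| tu : term 0%N
| tp : term 2%N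
| tgact n : G -> term n -> term n
| tsact n : term n -> 'S_n -> term n
| tgamma k (j : 'I_k -> nat) :
    term k -> (forall i, term (j i)) -> term (\sum_i j i)%N.

Fixpoint eval (P : operad G) (f : forall n, X n -> P n) n (t : term n) : P n :=
  match t in term m return P m with
  | tgen m x => f m x
  | tid => opid P
  | tu => mark_u P
  | tp => mark_p P
  | tgact m g t => gact g (eval f t)
  | tsact m t s => sact (eval f t) s
  | tgamma k j t ts => gamma P (eval f t) (fun i => eval f (ts i))
  end.

Definition teq n (t t' : term n) : Prop :=
  forall (P : operad G) f, V f -> @eval P f n t = eval f t'.

Definition gen_ops n : Type := {A : term n -> Prop | exists t, A = teq t}.

Lemma gen_ops_eq n (q q' : gen_ops n) : proj1_sig q = proj1_sig q' -> q = q'.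
Proof.
case: q q' => [A HA] [B HB] /= e.
by rewrite e in HA *; rewrite (Prop_irrelevance HA HB).
Qed.

Definition cls n (t : term n) : gen_ops n :=
  exist _ (teq t) (ex_intro _ t erefl).

Definition rep n (q : gen_ops n) : term n := projT1 (cid (proj2_sig q)).

Lemma clsP n (t t' : term n) : teq t t' <-> cls t = cls t'.
Proof.
split=> [e | /(congr1 (@proj1_sig _ _))/= ->]; last by [].
apply: gen_ops_eq => /=; apply/funext=> t''; apply/propext.
by split=> e' P f Vf; rewrite -?e' ?e // -e.
Qed.

Lemma repK n (q : gen_ops n) : cls (rep q) = q.
Proof.
by rewrite /rep; case: q => A H /=; case: cid => t /= e; apply: gen_ops_eq.
Qed.

Definition gen_eval (P : operad G) (f : forall n, X n -> P n) n (q : gen_ops n)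
  : P n := eval f (rep q).

Lemma gen_evalE (P : operad G) (f : forall n, X n -> P n) (Vf : V f) n
  (t : term n) : gen_eval f (cls t) = eval f t.
Proof. by have /clsP := repK (cls t); apply. Qed.

Lemma gen_opsP n (q q' : gen_ops n) :
  (forall (P : operad G) f, V f -> @gen_eval P f n q = gen_eval f q') -> q = q'.
Proof. by move=> e; rewrite -(repK q) -(repK q'); apply/clsP. Qed.

Lemma gen_opsTP m n (q : gen_ops m) (q' : gen_ops n) : m = n ->
  (forall (P : operad G) f, V f ->
     Tagged P (@gen_eval P f m q) = Tagged P (gen_eval f q')) ->
  Tagged gen_ops q = Tagged gen_ops q'.
Proof.
move=> e; case: _ / e q' => q' E; congr Tagged.
by apply: gen_opsP => P f /E; apply: Tagged_inj.
Qed.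

Definition gen_gact n (g : G) (q : gen_ops n) := cls (tgact g (rep q)).
Definition gen_sact n (q : gen_ops n) (s : 'S_n) := cls (tsact (rep q) s).
Definition gen_gamma k (j : 'I_k -> nat) (q : gen_ops k)
  (r : forall i, gen_ops (j i)) := cls (tgamma (rep q) (fun i => rep (r i))).

Section Eval.
Variables (P : operad G) (f : forall n, X n -> P n) (Vf : V f).

Lemma gen_eval_id : gen_eval f (cls tid) = opid P.
Proof. by rewrite gen_evalE. Qed.
Lemma gen_eval_u : gen_eval f (cls tu) = mark_u P.
Proof. by rewrite gen_evalE. Qed.
Lemma gen_eval_p : gen_eval f (cls tp) = mark_p P.
Proof. by rewrite gen_evalE. Qed.
Lemma gen_eval_gact n g (q : gen_ops n) :
  gen_eval f (gen_gact g q) = gact g (gen_eval f q).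
Proof. by rewrite gen_evalE. Qed.
Lemma gen_eval_sact n (q : gen_ops n) s :
  gen_eval f (gen_sact q s) = sact (gen_eval f q) s.
Proof. by rewrite gen_evalE. Qed.
Lemma gen_eval_gamma k (j : 'I_k -> nat) q (r : forall i, gen_ops (j i)) :
  gen_eval f (gen_gamma q r)
  = gamma P (gen_eval f q) (fun i => gen_eval f (r i)).
Proof. by rewrite gen_evalE. Qed.

Definition gen_evalS := (gen_eval_id, gen_eval_u, gen_eval_p, gen_eval_gact,
  gen_eval_sact, gen_eval_gamma).
End Eval.

Definition gen_symseq : symseq G.
Proof.
refine (@SymSeq G gen_ops gen_gact gen_sact _ _ _ _ _) => *;
  apply: gen_opsP => P f Vf; rewrite !gen_evalS //.
- exact: gact1.
- exact: gactM.
- exact: sact1.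
- exact: sactM.
- exact: gsactC.
Defined.

Lemma flatten_arity k (j : 'I_k -> nat) (m : 'I_(\sum_i j i)%N -> nat) :
  (\sum_a m a = \sum_i \sum_l m (@tagnat.Rank k j i l))%N.
Proof.
rewrite sig_big_dep /= (reindex (@tagnat.rank k j)) /=; last first.
  exact/onW_bij/tagnat.rank_bij.
by apply: eq_bigr => -[i l] _.
Qed.

Definition generated : operad G.
Proof.
refine (@Operad G gen_symseq (cls tid) gen_gamma (cls tu) (cls tp)
  _ _ _ _ _ _ _ _ _) => /=.
- by move=> g; apply: gen_opsP => P f Vf; rewrite !gen_evalS // gact_id.
- by move=> g; apply: gen_opsP => P f Vf; rewrite !gen_evalS // gact_u.
- by move=> g; apply: gen_opsP => P f Vf; rewrite !gen_evalS // gact_p.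
- move=> g k j x y; apply: gen_opsP => P f Vf; rewrite !gen_evalS // gact_gamma.
  by apply: eq_gamma => i; rewrite gen_evalS.
- move=> n x; apply: gen_opsTP => [|P f Vf]; first by rewrite big_ord1.
  by rewrite !gen_evalS // gamma1x.
- move=> n x; apply: gen_opsTP => [|P f Vf].
    by rewrite sum_nat_const card_ord muln1.
  by rewrite !gen_evalS // -[RHS]gammax1.
- move=> k j x y m z; apply: gen_opsTP => [|P f Vf]; first exact: flatten_arity.
  rewrite !gen_evalS // gammaA; congr Tagged.
  by apply: eq_gamma => i; rewrite gen_evalS.
- move=> k j x y t; apply: gen_opsP => P f Vf; rewrite !gen_evalS //.
  by rewrite -gamma_sact_in; apply: eq_gamma => i; rewrite gen_evalS.
- move=> k j x y s; apply: gen_opsTP => [|P f Vf]; first exact: block_perm_arity.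
  by rewrite !gen_evalS // gamma_sact_out.
Defined.

Definition gen_unit n (x : X n) : generated n := cls (tgen x).

Lemma gen_lift_seqmap (P : operad G) (f : forall n, X n -> P n) (Vf : V f) :
  @is_seqmap G generated P (gen_eval f).
Proof. by split=> *; rewrite gen_evalS. Qed.

Lemma gen_lift_opmap (P : operad G) (f : forall n, X n -> P n) (Vf : V f) :
  is_opmap (SeqMap (gen_lift_seqmap Vf)).
Proof. by split=> /= *; rewrite gen_evalS. Qed.

Definition gen_lift (P : operad G) (f : forall n, X n -> P n) (Vf : V f) :
  opmap generated P := OpMap (gen_lift_opmap Vf).

Lemma gen_lift_unit (P : operad G) (f : forall n, X n -> P n) (Vf : V f) n
  (x : X n) : gen_lift Vf n (gen_unit x) = f n x.
Proof. exact: gen_evalE. Qed.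

Lemma gen_lift_uniq (P : operad G) (h h' : opmap generated P) :
  (forall n x, h n (gen_unit x) = h' n (gen_unit x)) -> h = h'.
Proof.
move=> e; apply: opmap_eq => n q; rewrite -(repK q).
elim: {q}(rep q) => {n} [n x||||n g t IH|n t IH s|k j t IH ts IHs].
- exact: e.
- by rewrite (opmap_id (opmapP h)) (opmap_id (opmapP h')).
- by rewrite (opmap_u (opmapP h)) (opmap_u (opmapP h')).
- by rewrite (opmap_p (opmapP h)) (opmap_p (opmapP h')).
- have -> : cls (tgact g t) = gact g (cls t : generated n).
    by apply: gen_opsP => Q f Vf; rewrite gen_evalS // !gen_evalE.
  by rewrite !(seqfunP _).1 IH.
- have -> : cls (tsact t s) = sact (cls t : generated n) s.
    by apply: gen_opsP => Q f Vf; rewrite gen_evalS // !gen_evalE.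
  by rewrite !(seqfunP _).2 IH.
- have -> : cls (tgamma t ts) = gamma generated (cls t) (fun i => cls (ts i)).
    apply: gen_opsP => Q f Vf; rewrite gen_evalS // !gen_evalE //=.
    by apply: eq_gamma => i; rewrite gen_evalE.
  rewrite (opmap_gamma (opmapP h)) (opmap_gamma (opmapP h')) IH.
  exact: eq_gamma.
Qed.
End Generated.

Section Free.
Variable G : finGroupType.

Definition free_obj (S : SymSeqCat G) : OpCat G :=
  generated (fun P => @is_seqmap G S P).

Lemma free_eta_seqmap (S : SymSeqCat G) :
  @is_seqmap G S (free_obj S) (@gen_unit G S (fun P => @is_seqmap G S P)).
Proof.
split=> n; [move=> g x | move=> x s]; apply: gen_opsP => P f Vf.
  by rewrite gen_evalS // !gen_evalE // /= Vf.1.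
by rewrite gen_evalS // !gen_evalE // /= Vf.2.
Qed.

Definition free_eta (S : SymSeqCat G) : hom S (forget G (free_obj S)) :=
  SeqMap (free_eta_seqmap S).

Definition free_lift (S : SymSeqCat G) (P : OpCat G) (h : hom S (forget G P)) :
  hom (free_obj S) P :=
  @gen_lift G S (fun P => @is_seqmap G S P) P h (seqfunP h).

Lemma free_lift_eta S P (h : hom S (forget G P)) :
  compm (fmap (forget G) (free_lift h)) (free_eta S) = h.
Proof. by apply: seqmap_eq => n x; apply: (gen_lift_unit (seqfunP h)). Qed.

Lemma free_lift_uniq S P (k : hom (free_obj S) P) :
  free_lift (compm (fmap (forget G) k) (free_eta S)) = k.
Proof. by apply: gen_lift_uniq => n x; rewrite gen_lift_unit. Qed.

Definition free_op : functor (SymSeqCat G) (OpCat G) :=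
  univ_functor free_lift_eta free_lift_uniq.

Definition free_forget_adjunction : adjunction free_op (forget G) :=
  univ_adjunction free_lift_eta free_lift_uniq.
End Free.

Section Model.
Variable G : finGroupType.

Definition op_weq : arrow_class (OpCat G) := fun O P _ =>
  forall n (K : {group GSym G n}), graph_subgroup K ->
    (exists y : P n, fixed_by K y) -> exists x : O n, fixed_by K x.

Inductive gen_cof : arrow_class (OpCat G) :=
| GenCof n (K : {group GSym G n}) : graph_subgroup K ->
    gen_cof (fmap (free_op G) (from_empty (orbit_seq K))).

Inductive gen_acyclic_cof : arrow_class (OpCat G) :=
| GenAcyclicCof n (K : {group GSym G n}) : graph_subgroup K ->
    gen_acyclic_cof (fmap (free_op G) (inl_seq (orbit_seq K) (orbit_seq K))).

Definition op_model : model_data (OpCat G) :=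
  cofibrantly_generated op_weq gen_cof gen_acyclic_cof.
End Model.

(* Under [OpCat G = Fun(BG, Op_+)], [res f] is precomposition with [Bf]; the
   left and right Kan extensions along [Bf] are its left and right adjoints. *)
Section ChangeOfGroup.
Variables (G G' : finGroupType) (f : {morphism [set: G] >-> G'}).

Let fM g h : f (g * h) = f g * f h.
Proof. by rewrite morphM ?inE. Qed.

Definition res_seq (S : symseq G') : symseq G.
Proof.
refine (@SymSeq G (ops S) (fun n g x => gact (f g) x) (fun n x s => sact x s)
  _ _ _ _ _) => [n x|n g h x|n x|n x s t|n g x s].
- by rewrite morph1 gact1.
- by rewrite fM gactM.
- exact: sact1.
- exact: sactM.
- exact: gsactC.
Defined.

Definition res_obj (O : operad G') : operad G.
Proof.
refine (@Operad G (res_seq O) (opid O) (fun k j x y => gamma O x y)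
  (mark_u O) (mark_p O) _ _ _ _ _ _ _ _ _) => /=.
- by move=> g; apply: gact_id.
- by move=> g; apply: gact_u.
- by move=> g; apply: gact_p.
- by move=> g k j x y; apply: gact_gamma.
- exact: gamma1x.
- exact: gammax1.
- exact: gammaA.
- exact: gamma_sact_in.
- exact: gamma_sact_out.
Defined.

Lemma res_is_seqmap (O P : operad G') (h : opmap O P) :
  @is_seqmap G (res_obj O) (res_obj P) h.
Proof. by have [h1 h2] := seqfunP h; split=> *; [apply: h1 | apply: h2]. Qed.

Lemma res_is_opmap (O P : operad G') (h : opmap O P) :
  is_opmap (SeqMap (res_is_seqmap h)).
Proof. by have [h1 h2 h3 h4] := opmapP h; split. Qed.

Definition res : functor (OpCat G') (OpCat G).
Proof.
by refine (@Functor (OpCat G') (OpCat G) res_obj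
  (fun O P h => OpMap (res_is_opmap h)) _ _) => *; apply: opmap_eq.
Defined.

(* Induction: the operad generated by the operations of [O], subject to the
   relations that make the insertion of generators a morphism
   [O -> res (ind O)]. *)
Definition ind_rel (O : operad G) (P : operad G') (h : forall n, O n -> P n) :=
  exists k : opmap O (res_obj P), forall n, h n = k n.

Definition ind_obj (O : OpCat G) : OpCat G' := generated (@ind_rel O).

Lemma ind_eta_seqmap (O : OpCat G) :
  @is_seqmap G O (res (ind_obj O)) (@gen_unit G' O (@ind_rel O)).
Proof.
split=> n; [move=> g x | move=> x s]; apply: gen_opsP => P h Vh.
  rewrite (gen_eval_gact Vh) !gen_evalE // /=; case: Vh => k hk.
  by rewrite !hk (seqfunP k).1.
rewrite (gen_eval_sact Vh) !gen_evalE // /=; case: Vh => k hk.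
by rewrite !hk (seqfunP k).2.
Qed.

Lemma ind_eta_opmap (O : OpCat G) : is_opmap (SeqMap (ind_eta_seqmap O)).
Proof.
split=> [|m j x y||]; apply: gen_opsP => P h Vh.
- rewrite gen_evalE // gen_eval_id //=; case: Vh => k ->.
  exact: (opmap_id (opmapP k)).
- rewrite gen_evalE // (gen_eval_gamma Vh) /= gen_evalE //.
  case: (Vh) => k hk; rewrite /= !hk (opmap_gamma (opmapP k)).
  by apply: eq_gamma => i; rewrite gen_evalE //= hk.
- rewrite gen_evalE // gen_eval_u //=; case: Vh => k ->.
  exact: (opmap_u (opmapP k)).
- rewrite gen_evalE // gen_eval_p //=; case: Vh => k ->.
  exact: (opmap_p (opmapP k)).
Qed.

Definition ind_eta (O : OpCat G) : hom O (res (ind_obj O)) :=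
  OpMap (ind_eta_opmap O).

Lemma ind_relP (O : operad G) (P : operad G') (k : opmap O (res_obj P)) :
  @ind_rel O P k.
Proof. by exists k. Qed.

Definition ind_lift (O : OpCat G) (P : OpCat G') (k : hom O (res P)) :
  hom (ind_obj O) P := gen_lift (ind_relP k).

Lemma ind_lift_eta O P (k : hom O (res P)) :
  compm (fmap res (ind_lift k)) (ind_eta O) = k.
Proof. by apply: opmap_eq => n x; apply: (gen_lift_unit (ind_relP k)). Qed.

Lemma ind_lift_uniq O P (k : hom (ind_obj O) P) :
  ind_lift (compm (fmap res k) (ind_eta O)) = k.
Proof. by apply: gen_lift_uniq => n x; rewrite gen_lift_unit. Qed.

Definition ind : functor (OpCat G) (OpCat G') :=
  univ_functor ind_lift_eta ind_lift_uniq.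

Definition ind_res_adjunction : adjunction ind res :=
  univ_adjunction ind_lift_eta ind_lift_uniq.

Definition coind_ops (O : operad G) (n : nat) : Type :=
  {phi : G' -> O n | forall g x, phi (f g * x) = gact g (phi x)}.

Lemma coind_ops_eq (O : operad G) n (phi psi : coind_ops O n) :
  (forall x, sval phi x = sval psi x) -> phi = psi.
Proof.
case: phi psi => [phi H] [psi K] /= /funext e.
by rewrite e in H *; rewrite (Prop_irrelevance H K).
Qed.

Lemma coind_ops_eqT (O : operad G) m n (phi : coind_ops O m) (psi : coind_ops O n) :
  (forall x, Tagged O (sval phi x) = Tagged O (sval psi x)) ->
  Tagged (coind_ops O) phi = Tagged (coind_ops O) psi.
Proof.
move=> e; have emn : m = n := congr1 tag (e 1); case: _ / emn psi e => psi e.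
by congr Tagged; apply: coind_ops_eq => x; apply: Tagged_inj (e x).
Qed.

Section CoindObj.
Variable O : operad G.

Definition coind_const n (x : O n) (xP : forall g, gact g x = x) :
  coind_ops O n.
Proof. by exists (fun=> x) => g _; rewrite xP. Defined.

Lemma coind_gactP n g' (phi : coind_ops O n) :
  forall g x, sval phi (f g * x * g') = gact g (sval phi (x * g')).
Proof. by move=> g x; rewrite -mulgA (svalP phi). Qed.

Definition coind_gact n g' (phi : coind_ops O n) : coind_ops O n :=
  exist _ (fun x => sval phi (x * g')) (coind_gactP g' phi).

Lemma coind_sactP n (phi : coind_ops O n) s :
  forall g x, sact (sval phi (f g * x)) s = gact g (sact (sval phi x) s).
Proof. by move=> g x; rewrite (svalP phi) gsactC. Qed.

Definition coind_sact n (phi : coind_ops O n) s : coind_ops O n :=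
  exist _ (fun x => sact (sval phi x) s) (coind_sactP phi s).

Lemma coind_gammaP k (j : 'I_k -> nat) (phi : coind_ops O k)
    (psi : forall i, coind_ops O (j i)) :
  forall g x, gamma O (sval phi (f g * x)) (fun i => sval (psi i) (f g * x))
  = gact g (gamma O (sval phi x) (fun i => sval (psi i) x)).
Proof.
move=> g x; rewrite gact_gamma (svalP phi); apply: eq_gamma => i.
exact: svalP (psi i) _ _.
Qed.

Definition coind_gamma k (j : 'I_k -> nat) (phi : coind_ops O k)
    (psi : forall i, coind_ops O (j i)) : coind_ops O (\sum_i j i)%N :=
  exist _ (fun x => gamma O (sval phi x) (fun i => sval (psi i) x))
    (coind_gammaP phi psi).

Definition coind_seq : symseq G'.
Proof.
refine (@SymSeq G' (coind_ops O) coind_gact coind_sact _ _ _ _ _) => *;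
  apply: coind_ops_eq => x /=.
- by rewrite mulg1.
- by rewrite mulgA.
- exact: sact1.
- exact: sactM.
- by [].
Defined.

Definition coind_obj : operad G'.
Proof.
refine (@Operad G' coind_seq (coind_const (@gact_id G O)) coind_gamma
  (coind_const (@gact_u G O)) (coind_const (@gact_p G O))
  _ _ _ _ _ _ _ _ _) => /=.
- by move=> g; apply: coind_ops_eq.
- by move=> g; apply: coind_ops_eq.
- by move=> g; apply: coind_ops_eq.
- by move=> g k j phi psi; apply: coind_ops_eq.
- by move=> n phi; apply: coind_ops_eqT => x; apply: gamma1x.
- by move=> n phi; apply: coind_ops_eqT => x; apply: gammax1.
- by move=> k j phi psi m chi; apply: coind_ops_eqT => x; apply: gammaA.
- by move=> k j phi psi t; apply: coind_ops_eq => x; apply: gamma_sact_in.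
- by move=> k j phi psi s; apply: coind_ops_eqT => x; apply: gamma_sact_out.
Defined.
End CoindObj.

Section CoindMap.
Variables (O P : operad G) (h : opmap O P).

Lemma coind_mapP n (phi : coind_ops O n) :
  forall g x, h n (sval phi (f g * x)) = gact g (h n (sval phi x)).
Proof. by move=> g x; rewrite (svalP phi) (seqfunP h).1. Qed.

Definition coind_map n (phi : coind_obj O n) : coind_obj P n :=
  exist _ (fun x => h n (sval phi x)) (coind_mapP phi).

Lemma coind_map_seqmap : is_seqmap coind_map.
Proof.
split=> n *; apply: coind_ops_eq => x //=.
exact: (seqfunP h).2.
Qed.

Lemma coind_map_opmap : is_opmap (SeqMap coind_map_seqmap).
Proof.
have [h1 h2 h3 h4] := opmapP h.
by split=> *; apply: coind_ops_eq => x; [exact: h1|exact: h2|exact: h3|exact: h4].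
Qed.
End CoindMap.

Definition coind : functor (OpCat G) (OpCat G').
Proof.
by refine (@Functor (OpCat G) (OpCat G') coind_obj
  (fun O P h => OpMap (coind_map_opmap h)) _ _) => *; apply: opmap_eq => n phi;
  apply: coind_ops_eq.
Defined.

Section CoindTranspose.
Variables (O : OpCat G') (P : OpCat G).

Lemma coind_trP (h : hom (res O) P) n (x : O n) :
  forall g y, h n (gact (f g * y) x) = gact g (h n (gact y x)).
Proof. by move=> g y; rewrite gactM -(seqfunP h).1. Qed.

Definition coind_tr (h : hom (res O) P) n (x : O n) : coind P n :=
  exist _ (fun y => h n (gact y x)) (coind_trP h x).

Lemma coind_tr_seqmap (h : hom (res O) P) : is_seqmap (coind_tr h).
Proof.
split=> n *; apply: coind_ops_eq => x /=; first by rewrite gactM.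
by rewrite gsactC (seqfunP h).2.
Qed.

Lemma coind_tr_opmap (h : hom (res O) P) : is_opmap (SeqMap (coind_tr_seqmap h)).
Proof.
have [h1 h2 h3 h4] := opmapP h.
split=> *; apply: coind_ops_eq => x /=.
- by rewrite gact_id h1.
- by rewrite gact_gamma; apply: h2.
- by rewrite gact_u h3.
- by rewrite gact_p h4.
Qed.

Definition coind_transpose (h : hom (res O) P) : hom O (coind P) :=
  OpMap (coind_tr_opmap h).

Definition coind_untr (h : hom O (coind P)) n (x : res O n) : P n :=
  sval (h n x) 1.

Lemma coind_untr_seqmap (h : hom O (coind P)) : is_seqmap (coind_untr h).
Proof.
split=> [n g x|n x s]; rewrite /coind_untr.
  by rewrite [h n _](seqfunP h).1 /= mul1g -[f g]mulg1 (svalP (h n x)).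
by rewrite [h n _](seqfunP h).2.
Qed.

Lemma coind_untr_opmap (h : hom O (coind P)) :
  is_opmap (SeqMap (coind_untr_seqmap h)).
Proof.
have [h1 h2 h3 h4] := opmapP h.
by split=> *; rewrite /= /coind_untr /= ?h1 ?h2 ?h3 ?h4.
Qed.

Definition coind_untranspose (h : hom O (coind P)) : hom (res O) P :=
  OpMap (coind_untr_opmap h).

Lemma coind_transposeK : cancel coind_transpose coind_untranspose.
Proof.
by move=> h; apply: opmap_eq => n x; rewrite /= /coind_untr /= gact1.
Qed.

Lemma coind_untransposeK : cancel coind_untranspose coind_transpose.
Proof.
move=> h; apply: opmap_eq => n x; apply: coind_ops_eq => y.
by rewrite /= /coind_untr (seqfunP h).1 /= mul1g.
Qed.
End CoindTranspose.

Definition res_coind_adjunction : adjunction res coind.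
Proof.
refine (@Adjunction _ _ res coind coind_transpose coind_untranspose
  coind_transposeK coind_untransposeK _).
move=> O O' P P' g k h; apply: opmap_eq => n x; apply: coind_ops_eq => y /=.
by rewrite (seqfunP g).1.
Defined.
End ChangeOfGroup.

(* Main.v *)
(* An adjunction between these model categories is Quillen as soon as the left
   adjoint preserves cofibrations, that is, as soon as the right adjoint
   preserves the maps [p] that are surjective on fixed points of graph subgroups.
   Indeed an acyclic cofibration [A -> B] has a retraction, because it lifts
   against the projection [A x B -> B], and any operad map [B -> A] makes
   [A -> B] a weak equivalence.

   Fixed points of [coind f P] split, over the orbits of [G x K] on [G'], into
   fixed points of [P] under graph subgroups; fixed points of [res f P] are fixed
   points of [P] under the image subgroup, which is again a graph subgroup when
   [f] is injective.  If [f] is not injective, the graph of the regular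
   representation of [G] has fixed points in the restriction of a terminal
   operad, but none in that of a Sigma-free one.  A Sigma-free operad in which
   each graph subgroup fixes some operation is coinduced, from the trivial group,
   from the operad of injective maps [nat^n -> nat]. *)
From mathcomp Require Import all_boot all_order all_fingroup.
From mathcomp Require Import boolp.
Require Import Defs.

Set Implicit Arguments.
Unset Strict Implicit.
Unset Printing Implicit Defensive.

Local Open Scope group_scope.

(** * Lifting problems across an adjunction *)

Section LiftAdjunction.
Variables (C D : category) (L : functor C D) (R : functor D C).
Variable A : adjunction L R.

Lemma transpose_compl c d d' (k : hom d d') (h : hom (L c) d) :
  transpose A (compm k h) = compm (fmap R k) (transpose A h).
Proof. by have := transpose_nat A (idm c) k h; rewrite fmap1 !compm1. Qed.

Lemma transpose_compr c c' d (g : hom c' c) (h : hom (L c) d) :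
  transpose A (compm h (fmap L g)) = compm (transpose A h) g.
Proof. by have := transpose_nat A g (idm d) h; rewrite fmap1 !comp1m. Qed.

Lemma has_lift_adjunction (a b : C) (x y : D) (i : hom a b) (p : hom x y) :
  has_lift (fmap L i) p <-> has_lift i (fmap R p).
Proof.
have tr_inj c d := can_inj (@transposeK _ _ _ _ A c d).
have untr_inj c d := can_inj (@untransposeK _ _ _ _ A c d).
split=> lift_i u v e.
  have [|l l1 l2] := lift_i (untranspose A u) (untranspose A v).
    by apply: tr_inj; rewrite transpose_compl transpose_compr !untransposeK.
  exists (transpose A l); apply: untr_inj.
    by rewrite -transpose_compr transposeK.
  by rewrite -transpose_compl transposeK.
have [|l l1 l2] := lift_i (transpose A u) (transpose A v).
  by rewrite -transpose_compl e transpose_compr.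
exists (untranspose A l); apply: tr_inj.
  by rewrite transpose_compr untransposeK.
by rewrite transpose_compl untransposeK.
Qed.
End LiftAdjunction.

(** * Fixed points and lifting properties *)

Section FixedPoints.
Variable G : finGroupType.

Lemma prodact1 (S : symseq G) n (x : S n) : prodact 1 x = x.
Proof. by rewrite /prodact invg1 sact1 gact1. Qed.

Lemma prodactM (S : symseq G) n (a b : GSym G n) (x : S n) :
  prodact (a * b) x = prodact a (prodact b x).
Proof. by rewrite /prodact /= invMg sactM gactM -!gsactC. Qed.

Lemma seqmap_prodact (S T : symseq G) (f : seqmap S T) n (a : GSym G n) x :
  f n (prodact a x) = prodact a (f n x).
Proof. by rewrite /prodact (seqfunP f).1 (seqfunP f).2. Qed.

Lemma seqmap_fixed_by (S T : symseq G) (f : seqmap S T) n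
    (K : {group GSym G n}) (x : S n) : fixed_by K x -> fixed_by K (f n x).
Proof. by move=> Kx a Ka; rewrite -seqmap_prodact Kx. Qed.

Section Orbit.
Variables (n : nat) (K : {group GSym G n}).

Lemma orbit_baseP :
  (n == n) && ((K : {set GSym G n}) \in lcosets K [set: GSym G n]).
Proof.
by rewrite eqxx /=; apply/lcosetsP; exists 1; rewrite ?inE ?lcoset1.
Qed.

Definition orbit_base : orbit_seq K n := exist _ (K : {set GSym G n}) orbit_baseP.

Lemma val_orbit_prodact (a : GSym G n) (c : orbit_seq K n) :
  val (prodact a c) = a *: val c.
Proof.
case: a => g s; rewrite /prodact /= -lcosetM; congr (_ *: _); congr (_, _).
  by rewrite mulg1.
rewrite mul1g -[RHS]invgK; congr (_^-1); apply/permP=> i.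
by rewrite cast_permE (Prop_irrelevance (orbit_arity c) (erefl n)) !cast_ord_id.
Qed.

Lemma orbit_base_fixed : fixed_by K orbit_base.
Proof.
move=> a Ka; apply: val_inj.
by rewrite [LHS]val_orbit_prodact; apply: lcoset_id.
Qed.

Lemma orbit_seq_baseP (c : orbit_seq K n) :
  exists a : GSym G n, c = prodact a orbit_base.
Proof.
case/andP: (svalP c) => _ /lcosetsP[a _ e]; exists a; apply: val_inj.
by rewrite [RHS]val_orbit_prodact.
Qed.

Lemma orbit_seqmap_eq (S : symseq G) (f f' : seqmap (orbit_seq K) S) :
  f n orbit_base = f' n orbit_base -> f = f'.
Proof.
move=> e; apply: seqmap_eq => m c; move: (orbit_arity c) => emn; subst m.
by have [a ->] := orbit_seq_baseP c; rewrite !seqmap_prodact e.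
Qed.

Section OrbitMap.
Variables (S : symseq G) (x : S n).

(** The coset [a K] goes to [a x], computed on a chosen representative; the choice is immaterial
    once [K] fixes [x]. The cast carries the value from arity [n] to the propositionally equal arity
    [m]. *)
Definition orbit_map m (c : orbit_seq K m) : S m :=
  ecast m (S m) (esym (orbit_arity c)) (prodact (repr (val c)) x).

Lemma orbit_mapE (a : GSym G n) : fixed_by K x ->
  orbit_map (prodact a orbit_base) = prodact a x.
Proof.
move=> Kx; rewrite /orbit_map.
rewrite (Prop_irrelevance (orbit_arity _) (erefl n)) /=.
rewrite [X in repr X]val_orbit_prodact.
have [k Kk ->] : exists2 k, k \in K & repr (a *: K) = a * k.
  by apply/lcosetP/(mem_repr a)/lcoset_refl.
by rewrite prodactM Kx.
Qed.

Lemma orbit_map_seqmap : fixed_by K x -> is_seqmap orbit_map.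
Proof.
move=> Kx; split=> m.
  move=> g c; move: (orbit_arity c) => emn; subst m.
  have [a ->] := orbit_seq_baseP c; rewrite orbit_mapE //.
  have E (T : symseq G) (y : T n) : gact g y = prodact ((g, 1) : GSym G n) y.
    by rewrite /prodact /= invg1 sact1.
  by rewrite !E -!prodactM orbit_mapE.
move=> c s; move: (orbit_arity c) => emn; subst m.
have [a ->] := orbit_seq_baseP c; rewrite orbit_mapE //.
have E (T : symseq G) (y : T n) : sact y s = prodact ((1, s^-1) : GSym G n) y.
  by rewrite /prodact /= invgK gact1.
by rewrite !E -!prodactM orbit_mapE.
Qed.
End OrbitMap.

Definition orbit_seqmap (S : symseq G) (x : S n) (Kx : fixed_by K x) :
  seqmap (orbit_seq K) S := SeqMap (orbit_map_seqmap Kx).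

Lemma orbit_seqmap_base (S : symseq G) (x : S n) (Kx : fixed_by K x) :
  orbit_seqmap Kx n orbit_base = x.
Proof. by rewrite /= -[orbit_base]prodact1 orbit_mapE // prodact1. Qed.
End Orbit.

(** Explicit form, by [rlp_gen_cofP], of the right lifting property against the generating
    cofibrations. *)
Definition fixed_surj (X Y : operad G) (p : opmap X Y) : Prop :=
  forall n (K : {group GSym G n}), graph_subgroup K ->
  forall y : Y n, fixed_by K y -> exists2 x : X n, fixed_by K x & p n x = y.

(** The orbit of [K] corepresents [K]-fixed operations: a map out of it is determined by the image
    of the base coset, which may be any fixed operation. *)
Lemma has_lift_from_empty (X Y : SymSeqCat G) (p : hom X Y) n
    (K : {group GSym G n}) :
  has_lift (from_empty (orbit_seq K)) p <->
  forall y : Y n, fixed_by K y -> exists2 x : X n, fixed_by K x & p n x = y.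
Proof.
split=> [lift_p y Ky | surj_p u v e].
  have [|l _ l2] := lift_p (from_empty X) (orbit_seqmap Ky).
    by apply: seqmap_eq => m [].
  exists (l n (orbit_base K)); first exact/seqmap_fixed_by/orbit_base_fixed.
  by rewrite -[RHS](orbit_seqmap_base Ky) -l2.
have [x Kx px] := surj_p _ (seqmap_fixed_by v (@orbit_base_fixed n K)).
exists (orbit_seqmap Kx); first by apply: seqmap_eq => m [].
by apply: orbit_seqmap_eq; rewrite -px /= -[in RHS](orbit_seqmap_base Kx).
Qed.

Lemma rlp_gen_cofP (X Y : OpCat G) (p : hom X Y) :
  rlp (@gen_cof G) p <-> fixed_surj p.
Proof.
split=> [rlp_p n K graphK | surj_p a b i [n K graphK]].
  apply/(@has_lift_from_empty _ _ (fmap (forget G) p)).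
  exact/(has_lift_adjunction (free_forget_adjunction G))/rlp_p.
apply/(has_lift_adjunction (free_forget_adjunction G)).
exact/has_lift_from_empty/surj_p.
Qed.

Lemma Tagged_pair (S T : nat -> Type) m m' (x : S m) (x' : S m') (y : T m)
    (y' : T m') :
  Tagged S x = Tagged S x' -> Tagged T y = Tagged T y' ->
  Tagged (fun n => S n * T n)%type (x, y)
  = Tagged (fun n => S n * T n)%type (x', y').
Proof.
move=> ex; have e : m = m' := congr1 tag ex; case: _ / e x' y' ex => x' y' ex ey.
by rewrite (Tagged_inj ex) (Tagged_inj ey).
Qed.

(** * Products of operads and retractions of acyclic cofibrations *)

Section Product.
Variables A B : operad G.

Definition prod_seq : symseq G.
Proof.
refine (@SymSeq G (fun n => A n * B n)%type
  (fun n g x => (gact g x.1, gact g x.2))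
  (fun n x s => (sact x.1 s, sact x.2 s)) _ _ _ _ _).
- by move=> n [x y]; rewrite !gact1.
- by move=> n g h [x y]; rewrite !gactM.
- by move=> n [x y]; rewrite !sact1.
- by move=> n [x y] s t; rewrite !sactM.
- by move=> n g [x y] s; rewrite !gsactC.
Defined.

Definition prod_obj : operad G.
Proof.
refine (@Operad G prod_seq (opid A, opid B)
  (fun k j x y => (gamma A x.1 (fun i => (y i).1), gamma B x.2 (fun i => (y i).2)))
  (mark_u A, mark_u B) (mark_p A, mark_p B) _ _ _ _ _ _ _ _ _) => /=.
- by move=> g; rewrite !gact_id.
- by move=> g; rewrite !gact_u.
- by move=> g; rewrite !gact_p.
- by move=> *; rewrite !gact_gamma.
- by move=> n [x y]; apply: Tagged_pair; apply: gamma1x.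
- by move=> n [x y]; apply: Tagged_pair; apply: gammax1.
- by move=> *; apply: Tagged_pair; apply: gammaA.
- by move=> *; rewrite -!gamma_sact_in.
- by move=> *; apply: Tagged_pair; apply: gamma_sact_out.
Defined.

Lemma prod_snd_seqmap : @is_seqmap G prod_obj B (fun n => snd).
Proof. by []. Qed.

Lemma prod_snd_opmap : is_opmap (SeqMap prod_snd_seqmap).
Proof. by []. Qed.

Definition prod_snd : opmap prod_obj B := OpMap prod_snd_opmap.

Lemma prod_fst_seqmap : @is_seqmap G prod_obj A (fun n => fst).
Proof. by []. Qed.

Lemma prod_fst_opmap : is_opmap (SeqMap prod_fst_seqmap).
Proof. by []. Qed.

Definition prod_fst : opmap prod_obj A := OpMap prod_fst_opmap.
End Product.

Section Graph.
Variables (A B : operad G) (i : opmap A B).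

Lemma op_graph_seqmap : @is_seqmap G A (prod_obj A B) (fun n x => (x, i n x)).
Proof. by split=> n *; rewrite ?(seqfunP i).1 ?(seqfunP i).2. Qed.

Lemma op_graph_opmap : is_opmap (SeqMap op_graph_seqmap).
Proof.
have [i1 i2 i3 i4] := opmapP i.
by split=> *; rewrite /= ?i1 ?i2 ?i3 ?i4.
Qed.

Definition op_graph : opmap A (prod_obj A B) := OpMap op_graph_opmap.
End Graph.

Lemma acyclic_cof_retract (A B : OpCat G) (i : hom A B) :
  cof (op_model G) i -> weq (op_model G) i ->
  exists r : hom B A, compm r i = idm A.
Proof.
move=> cof_i weq_i.
have : rlp (@gen_cof G) (prod_snd A B : hom (c := OpCat G) (prod_obj A B) B).
  apply/rlp_gen_cofP=> n K graphK y Ky.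
  (* As [i] is a weak equivalence, a fixed operation of [B] forces one in [A]; the pair lifts [y]
     along the projection. *)
  have [x Kx] := weq_i n K graphK (ex_intro _ y Ky).
  by exists (x, y) => // a Ka; rewrite -[RHS](congr2 pair (Kx a Ka) (Ky a Ka)).
(* The square has the graph of [i] on top and the identity of [B] below; the first coordinate of its
   lift retracts [i]. *)
case/cof_i/(_ (op_graph i) (idm B)); first exact: opmap_eq.
move=> l li _; exists (compm (c := OpCat G) (prod_fst A B) l).
by rewrite -compmA li; apply: opmap_eq.
Qed.

Lemma retract_weq (A B : OpCat G) (i : hom A B) (r : hom B A) :
  op_weq i.
Proof.
by move=> n K _ [y Ky]; exists (r n y); apply: seqmap_fixed_by.
Qed.
End FixedPoints.

(** * Quillen adjunctions in terms of fixed operations *)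

Section Quillen.
Variables (G G' : finGroupType).
Variables (L : functor (OpCat G) (OpCat G')) (R : functor (OpCat G') (OpCat G)).
Variable A : adjunction L R.

Lemma Quillen_fixed_surjP :
  Quillen_adjunction (op_model G) (op_model G') A <->
  forall (X Y : OpCat G') (p : hom X Y), fixed_surj p -> fixed_surj (fmap R p).
Proof.
split=> [[cofL _] X Y p /rlp_gen_cofP surj_p | surjR].
  apply/rlp_gen_cofP=> a b i gen_i; apply/(has_lift_adjunction A).
  (* A generating cofibration lifts against every map that lifts against all generators, so it is a
     cofibration. *)
  by apply: cofL surj_p => x y q; apply.
have cofL (x y : OpCat G) (i : hom x y) :
    cof (op_model G) i -> cof (op_model G') (fmap L i).
  move=> cof_i X Y p /rlp_gen_cofP surj_p; apply/(has_lift_adjunction A).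
  exact/cof_i/rlp_gen_cofP/surjR.
split=> // x y i cof_i weq_i; split; first exact: cofL.
have [r _] := acyclic_cof_retract cof_i weq_i.
exact: retract_weq (fmap L r).
Qed.
End Quillen.

(** * Restriction and coinduction of fixed points *)

(** A subgroup meeting [1 x S_n] trivially projects injectively to [G], hence is the graph of a
    function on its projection [H]. *)
Lemma graph_subgroupP (G : finGroupType) n (K : {group GSym G n}) :
  graph_subgroup K <-> forall s, ((1, s) : GSym G n) \in K -> s = 1.
Proof.
split=> [[H [s eK]] t | K1].
  by rewrite eK => /imsetP[h Hh [e ->]]; rewrite -e morph1.
pose H := [group of [morphism of @fst G 'S_n] @* K].
have KE (g : G) s t : ((g, s) : GSym G n) \in K -> (g, t) \in K -> s = t.
  move=> Ks Kt; apply/eqP; rewrite eq_mulVg1; apply/eqP/K1.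
  have -> : ((1, s^-1 * t) : GSym G n) = (g, s)^-1 * (g, t).
    by rewrite -[1](mulVg g).
  by rewrite groupM ?groupV.
(* [repr] picks the unique pair of [K] over [h]; outside [H] the set is empty and [repr] returns
   1. *)
pose sigma h := (repr [set k in K | k.1 == h]).2.
have sigmaP h : h \in H -> ((h, sigma h) : GSym G n) \in K.
  case/morphimP=> -[h' s] _ Kk /= e.
  have /mem_repr : ((h', s) : GSym G n) \in [set k in K | k.1 == h].
    by rewrite inE Kk e eqxx.
  rewrite inE /sigma; case: (repr _) => h'' t /= /andP[? /eqP <-] //.
have sigmaM : {in H &, {morph sigma : g h / g * h}}.
  move=> g h Hg Hh; apply: (KE (g * h)); first by rewrite sigmaP ?groupM.
  by have := groupM (sigmaP g Hg) (sigmaP h Hh).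
exists H, (Morphism sigmaM); apply/setP=> -[g s]; apply/idP/imsetP => /=.
  move=> Ks; have Hg : g \in H.
    by apply/morphimP; exists (g, s); rewrite ?inE.
  by exists g => //; congr (_, _); apply: KE Ks (sigmaP g Hg).
by case=> h Hh [-> ->]; apply: sigmaP.
Qed.

Section ChangeOfGroup.
Variables (G G' : finGroupType) (f : {morphism [set: G] >-> G'}).

Lemma res_prodact (O : operad G') n (a : GSym G n) (x : O n) :
  prodact (S := res_obj f O) a x = prodact ((f a.1, a.2) : GSym G' n) x.
Proof. by []. Qed.

Lemma morph_prod_group_set n (K : {group GSym G n}) :
  group_set [set ((f a.1, a.2) : GSym G' n) | a in K].
Proof.
apply/group_setP; split=> [|_ _ /imsetP[a Ka ->] /imsetP[b Kb ->]].
  by apply/imsetP; exists 1; rewrite ?group1 //= morph1.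
by apply/imsetP; exists (a * b); rewrite ?groupM //= morphM ?inE.
Qed.

Lemma res_fixed_surj : injective f ->
  forall (X Y : OpCat G') (p : hom X Y), fixed_surj p -> fixed_surj (fmap (res f) p).
Proof.
move=> inj_f X Y p surj_p n K /graph_subgroupP graphK y Ky.
case: (surj_p n (Group (morph_prod_group_set K)) _ y).
(* A pair [(f g, t)] over 1 has [g = 1] because [f] is injective, and then [t = 1] because [K] is a
   graph. *)
- apply/graph_subgroupP=> s /imsetP[[g t] Ka [e ->]].
  by apply: graphK; rewrite -(_ : g = 1) //; apply: inj_f; rewrite morph1.
- by move=> _ /imsetP[a Ka ->]; rewrite -res_prodact Ky.
- by move=> x Kx px; exists x => // a Ka; rewrite res_prodact Kx ?imset_f.
Qed.

Section CoindFixed.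
Variables (n : nat) (K : {group GSym G' n}).

(* Evaluating at [x] sends a [K]-fixed operation of [coind P] to one that is
   fixed by this stabilizer of [x] under [(g, k) . x = f g * x * k.1^-1]. *)
Definition coind_stab (x : G') : {set GSym G n} :=
  [set a | ((f a.1 ^ x, a.2) : GSym G' n) \in K].

Lemma coind_stab_group_set x : group_set (coind_stab x).
Proof.
apply/group_setP; split=> [|a b]; first by rewrite inE /= morph1 conj1g group1.
rewrite !inE /= => Ka Kb; rewrite morphM ?inE // conjMg.
exact: (groupM Ka Kb).
Qed.

Definition coind_stab_group x := Group (coind_stab_group_set x).

Lemma coind_stab_graph x : graph_subgroup K -> graph_subgroup (coind_stab_group x).
Proof.
move=> /graph_subgroupP graphK; apply/graph_subgroupP=> s.
by rewrite inE /= morph1 conj1g; apply: graphK.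
Qed.

Lemma coind_fixedP (P : operad G) (psi : coind_ops f P n) :
  fixed_by (S := coind_obj f P) K psi <->
  forall k x, k \in K -> sact (sval psi (x * k.1)) k.2^-1 = sval psi x.
Proof.
split=> [Kpsi k x Kk | e k Kk]; first by rewrite -[in RHS](Kpsi k Kk).
by apply: coind_ops_eq => x; rewrite /= e.
Qed.

(** Since [x * (f g ^ x) = f g * x], invariance of [psi] under [(f g ^ x, s)], read at [x], becomes
    invariance of its value under [(g, s)] by equivariance along [f]. *)
Lemma coind_fixed_stab (P : operad G) (psi : coind_ops f P n) x :
  fixed_by (S := coind_obj f P) K psi ->
  fixed_by (coind_stab_group x) (sval psi x).
Proof.
move=> /coind_fixedP Kpsi a; rewrite inE => Ka.
rewrite /prodact gsactC -(svalP psi).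
by have := Kpsi _ x Ka; rewrite /= conjgE !mulgA mulgV mul1g.
Qed.

(** The left factor is the image of [f], the right one the projection of [K] to [G']. The chosen
    representative serves as a base point. *)
Definition double_coset (x : G') : {set G'} :=
  [set y | [exists a : G * GSym G' n, (a.2 \in K) && (y == f a.1 * x * a.2.1^-1)]].

Lemma double_cosetP x y :
  reflect (exists g k, k \in K /\ y = f g * x * k.1^-1) (y \in double_coset x).
Proof.
rewrite inE; apply: (iffP existsP) => [[[g k] /= /andP[Kk /eqP ->]]|[g [k [Kk ->]]]].
  by exists g, k.
by exists (g, k); rewrite /= Kk eqxx.
Qed.

Lemma double_coset_move g k x : k \in K ->
  double_coset (f g * x * k.1^-1) = double_coset x.
Proof.
move=> Kk; apply/setP=> y; apply/double_cosetP/double_cosetP=> -[h [l [Kl ->]]].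
  exists (h * g), (l * k); rewrite groupM //; split=> //=.
  by rewrite morphM ?inE // invMg !mulgA.
exists (h * g^-1), (l * k^-1); rewrite groupM ?groupV //; split=> //=.
by rewrite morphM ?morphV ?inE // invMg invgK !mulgA !mulgKV.
Qed.

Lemma double_coset_reprP x :
  exists g k, k \in K /\ x = f g * repr (double_coset x) * k.1^-1.
Proof.
have : repr (double_coset x) \in double_coset x.
  apply: (mem_repr x); apply/double_cosetP; exists 1, 1.
  by rewrite group1 morph1 mul1g invg1 mulg1.
case/double_cosetP=> g [k [Kk e]]; exists g^-1, k^-1; rewrite groupV; split=> //.
by rewrite e morphV ?inE //= invgK !mulgA mulVg mul1g mulgKV.
Qed.
End CoindFixed.

(** A lift fixed by the stabilizer is chosen at the base point of each double coset and spread over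
    that double coset by the two actions. *)
Lemma coind_fixed_surj (X Y : OpCat G) (p : hom X Y) :
  fixed_surj p -> fixed_surj (fmap (coind f) p).
Proof.
move=> surj_p n K graphK psi Kpsi.
have /choice[chi chiP] x : exists z : X n,
    fixed_by (coind_stab_group K x) z /\ p n z = sval psi x.
  have [||z Kz pz] := surj_p n (coind_stab_group K x) _ (sval psi x).
  - exact: coind_stab_graph.
  - exact: coind_fixed_stab.
  - by exists z.
pose r x := repr (double_coset K x).
have /choice[d dP] x : exists d : G * GSym G' n,
    d.2 \in K /\ x = f d.1 * r x * d.2.1^-1.
  by have [g [k gkP]] := double_coset_reprP K x; exists (g, k).
pose phi x := prodact (((d x).1, (d x).2.2) : GSym G n) (chi (r x)).
(* Independence of the coordinates of [x]: two choices differ by an element of the stabilizer of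
   [r x], which fixes [chi (r x)]. *)
have phiE x g k : k \in K -> x = f g * r x * k.1^-1 ->
    phi x = prodact ((g, k.2) : GSym G n) (chi (r x)).
  move=> Kk ex; have [Kd edx] := dP x; have [stab_chi _] := chiP (r x).
  pose a : GSym G n := ((d x).1, (d x).2.2); pose b : GSym G n := (g, k.2).
  rewrite /phi -/a -/b -[b](mulKVg a) (prodactM a).
  rewrite [prodact (a^-1 * b) _]stab_chi // inE.
  (* Equating the two expressions for [x] identifies the pair to be tested with [(d x).2^-1 * k],
     which lies in [K]. *)
  have /= -> : f (a^-1 * b).1 ^ r x = (d x).2.1^-1 * k.1.
    rewrite morphM ?morphV ?inE // conjgE.
    move: edx; rewrite [LHS]ex.
    move=> /(congr1 (fun z => (r x)^-1 * (f (d x).1)^-1 * z * k.1)).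
    by rewrite !mulgA !mulgKV mulVg mul1g.
  exact: groupM (groupVr Kd) Kk.
have rE g k x : k \in K -> r (f g * x * k.1^-1) = r x.
  by move=> Kk; rewrite /r double_coset_move.
have phi_equiv h x : phi (f h * x) = gact h (phi x).
  have [Kd edx] := dP x.
  have rhx : r (f h * x) = r x.
    by have := rE h 1 x (group1 K); rewrite invg1 mulg1.
  rewrite (phiE _ (h * (d x).1) (d x).2) // rhx; last first.
    by rewrite morphM ?inE // -!mulgA {1}edx !mulgA.
  by rewrite /phi /prodact /= gactM.
have phi_fixed k x : k \in K -> sact (phi (x * k.1)) k.2^-1 = phi x.
  move=> Kk; have [Kd edx] := dP x.
  have rxk : r (x * k.1) = r x.
    by have := rE 1 k^-1 x (groupVr Kk); rewrite morph1 mul1g invgK.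
  rewrite (phiE _ (d x).1 (k^-1 * (d x).2)) ?groupM ?groupV // rxk; last first.
    by rewrite /= invMg invgK {1}edx !mulgA.
  by rewrite /phi /prodact /= -gsactC -sactM invMg invgK mulgK.
exists (exist _ phi phi_equiv); first exact/coind_fixedP.
apply: coind_ops_eq => x /=; have [Kd edx] := dP x; have [_ pchi] := chiP (r x).
(* Being equivariant and fixed by [K], [psi] obeys the formula defining [phi], and [p] matches the
   two at [r x]. *)
rewrite /phi seqmap_prodact pchi /prodact /= gsactC -(svalP psi).
have /coind_fixedP/(_ _ (f (d x).1 * r x * (d x).2.1^-1) Kd) := Kpsi.
by rewrite mulgKV -edx.
Qed.
End ChangeOfGroup.

(** * A Sigma-free operad *)

Section RankRank.
Variables (k : nat) (j : 'I_k -> nat) (m : 'I_(\sum_i j i)%N -> nat).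

(** Flattening in one stage or in two gives the same lexicographic order, whence associativity in
    [inj_obj]. A position is the total size of the earlier blocks plus an offset, so the proof
    compares sums. *)
Lemma Rank_Rank i (l : 'I_(j i)) (q : 'I_(m (@tagnat.Rank k j i l))) :
  @tagnat.Rank _ m _ q =
  @tagnat.Rank k (fun i => \sum_l m (@tagnat.Rank k j i l))%N i
    (@tagnat.Rank (j i) (fun l => m (@tagnat.Rank k j i l)) l q) :> nat.
Proof.
rewrite [LHS]tagnat.RankEsum [RHS]tagnat.RankEsum (@tagnat.RankEsum (j i)) addnA.
congr (_ + _)%N.
have ltE i' (l' : 'I_(j i')) :
    (tagnat.Rank i' l' < tagnat.Rank i l)%N = (i' < i)%N || (i' == i) && (l' < l)%N.
  transitivity (Order.lt (tagnat.rank (Tagged _ l')) (tagnat.Rank i l)).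
    by rewrite Order.OrdinalOrder.ltEord.
  rewrite tagnat.lt_rank Order.SigmaOrder.ltEsig /= !Order.OrdinalOrder.leEord.
  case: (ltngtP i' i) => [lt_i|gt_i|/val_inj/esym ei] //=.
    by rewrite -val_eqE gtn_eqF.
  by case: _ / ei l' => l'; rewrite tagged_asE eqxx Order.OrdinalOrder.ltEord.
(* The indices before [(i, l)] fill the blocks [i' < i] entirely and the block [i] up to [l]. *)
transitivity (\sum_i' \sum_(l' < j i' | (i' < i) || (i' == i) && (l' < l))
    m (tagnat.Rank i' l'))%N.
  rewrite sig_big_dep (reindex (@tagnat.rank k j)); last first.
    exact/onW_bij/tagnat.rank_bij.
  by apply: eq_big => -[i' l'] //=; rewrite -ltE.
rewrite (bigID (fun i' : 'I_k => (i' < i)%N)) /=; congr (_ + _)%N.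
  by apply: eq_bigr => i' ->.
rewrite (bigD1 i) ?ltnn //= [X in (_ + X)%N]big1 ?addn0; last first.
  by move=> i' /andP[/negPf lt_i' /negPf ne_i']; rewrite lt_i' ne_i' big_pred0.
by apply: eq_bigl => l'; rewrite eqxx.
Qed.
End RankRank.

(** The type of [sig2] depends on [sig1], so both are replaced at once under a function [F] of the
    pair. *)
Lemma sig_Rank k (j : 'I_k -> nat) T (F : forall i, 'I_(j i) -> T) i (l : 'I_(j i)) :
  F (tagnat.sig1 (tagnat.Rank i l)) (tagnat.sig2 (tagnat.Rank i l)) = F i l.
Proof. by rewrite /tagnat.sig1 /tagnat.sig2 tagnat.rankK. Qed.

Section Terminal.
Variable G : finGroupType.

Definition terminal_seq : symseq G.
Proof.
by refine (@SymSeq G (fun=> unit) (fun _ _ x => x) (fun _ x _ => x) _ _ _ _ _).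
Defined.

Lemma Tagged_unit m n (x y : unit) : m = n ->
  Tagged (fun _ : nat => unit) (i := m) x = Tagged (fun _ : nat => unit) (i := n) y.
Proof. by case: x y => -[] ->. Qed.

Definition terminal_obj : operad G.
Proof.
refine (@Operad G terminal_seq tt (fun _ _ _ _ => tt) tt tt
  _ _ _ _ _ _ _ _ _) => // [n x|n x|k j x y m z|k j x y s]; apply: Tagged_unit.
- by rewrite big_ord1.
- by rewrite sum_nat_const card_ord muln1.
- exact: flatten_arity.
- exact: block_perm_arity.
Defined.
End Terminal.

(** * The operad of injective maps from powers of the natural numbers *)

Section InjectiveOperations.

Definition inj_ops (n : nat) : Type := {x : ('I_n -> nat) -> nat | injective x}.

Lemma inj_ops_eq n (x y : inj_ops n) : sval x =1 sval y -> x = y.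
Proof.
case: x y => [x Hx] [y Hy] /= /funext e.
by rewrite e in Hx *; rewrite (Prop_irrelevance Hx Hy).
Qed.

Lemma inj_ops_eqT m n (x : inj_ops m) (y : inj_ops n) (e : m = n) :
  (forall v : 'I_n -> nat, sval x (fun i => v (cast_ord e i)) = sval y v) ->
  Tagged inj_ops x = Tagged inj_ops y.
Proof.
case: _ / e y => y exy; congr Tagged; apply: inj_ops_eq => v.
by rewrite -exy; congr (sval x _); apply/funext=> i; rewrite cast_ord_id.
Qed.

Lemma inj_sactP n (x : inj_ops n) (s : 'S_n) :
  injective (fun v : 'I_n -> nat => sval x (fun i => v (s i))).
Proof.
have x_inj : injective (sval x) := proj2_sig x.
move=> v w /x_inj e; apply/funext=> i.
by have := congr1 (@^~ (s^-1 i)) e; rewrite /= permKV.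
Qed.

Definition inj_sact n (x : inj_ops n) (s : 'S_n) : inj_ops n :=
  exist _ _ (@inj_sactP n x s).

Lemma inj_gammaP k (j : 'I_k -> nat) (x : inj_ops k) (y : forall i, inj_ops (j i)) :
  injective (fun v : 'I_(\sum_i j i) -> nat =>
    sval x (fun i => sval (y i) (fun l => v (@tagnat.Rank k j i l)))).
Proof.
have x_inj : injective (sval x) := proj2_sig x.
have y_inj i : injective (sval (y i)) := proj2_sig (y i).
move=> v w /x_inj e; apply/funext=> a; rewrite -(tagnat.sig2K a).
have /y_inj := congr1 (@^~ (tagnat.sig1 a)) e.
exact: (congr1 (@^~ (tagnat.sig2 a))).
Qed.

Definition inj_gamma k (j : 'I_k -> nat) (x : inj_ops k)
    (y : forall i, inj_ops (j i)) : inj_ops (\sum_i j i)%N :=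
  exist _ _ (@inj_gammaP k j x y).

(** Tuples of naturals, seen as finite functions, form a countable type, and their codes are
    injective. This gives an operation in each arity, including the two markings. *)
Lemma inj_opP n :
  injective (fun v : 'I_n -> nat => pickle [ffun i => v i]).
Proof.
move=> v w /(pcan_inj pickleK) /ffunP e; apply/funext=> i.
by have := e i; rewrite !ffunE.
Qed.

Definition inj_op n : inj_ops n := exist _ _ (@inj_opP n).

Lemma inj_idP : injective (fun v : 'I_1 -> nat => v ord0).
Proof. by move=> v w e; apply/funext=> i; rewrite (ord1 i). Qed.

Variable G : finGroupType.

Definition inj_seq : symseq G.
Proof.
refine (@SymSeq G inj_ops (fun _ _ x => x) inj_sact _ _ _ _ _) => //.
  by move=> n x; apply: inj_ops_eq => v; congr (sval x _); apply/funext=> i;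
    rewrite perm1.
by move=> n x s t; apply: inj_ops_eq => v; congr (sval x _); apply/funext=> i;
  rewrite permM.
Defined.

Definition inj_obj : operad G.
Proof.
refine (@Operad G inj_seq (exist _ _ (@inj_idP)) inj_gamma (inj_op 0) (inj_op 2)
  _ _ _ _ _ _ _ _ _) => //=.
- move=> n x.
  have e : \sum_(i < 1) n = n by rewrite big_ord1.
  apply: (@inj_ops_eqT _ _ _ _ e) => v /=; congr (sval x _); apply/funext=> l.
  congr v; apply: val_inj.
  by rewrite [LHS](@tagnat.RankEsum 1 (fun=> n)) big1.
- move=> n x.
  have e : \sum_(i < n) 1 = n by rewrite sum_nat_const card_ord muln1.
  apply: (@inj_ops_eqT _ _ _ _ e) => v /=; congr (sval x _); apply/funext=> i.
  congr v; apply: val_inj.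
  (* All blocks have size one, so the input of block [i] is preceded by exactly [i] inputs. *)
  rewrite [LHS](@tagnat.RankEsum n (fun=> 1%N)) addn0.
  by rewrite -(big_ord_widen n (fun=> 1%N) (ltnW (ltn_ord i))) sum1_card card_ord.
- move=> k j x y m z; apply: (@inj_ops_eqT _ _ _ _ (flatten_arity m)) => v /=.
  congr (sval x _); apply/funext=> i; congr (sval (y i) _); apply/funext=> l.
  congr (sval (z _) _); apply/funext=> q; congr v; apply: val_inj.
  exact: Rank_Rank.
- move=> k j x y t; apply: inj_ops_eq => v /=.
  congr (sval x _); apply/funext=> i; congr (sval (y i) _); apply/funext=> l.
  congr v; rewrite permE /=.
  exact/esym/(@sig_Rank _ _ _ (fun i l => tagnat.Rank i (t i l))).
- move=> k j x y s; apply: esym.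
  apply: (@inj_ops_eqT _ _ _ _ (esym (block_perm_arity j s))) => v /=.
  congr (sval x _); apply/funext=> i; congr (sval (y _) _); apply/funext=> l.
  congr v; rewrite permE; apply: val_inj => /=.
  exact: (@sig_Rank _ _ _ (fun i l => tagnat.Rank (s i) l : nat)).
Defined.
End InjectiveOperations.

Lemma to_terminal_seqmap (G : finGroupType) (O : operad G) :
  @is_seqmap G O (terminal_obj G) (fun _ _ => tt).
Proof. by []. Qed.

Lemma to_terminal_opmap (G : finGroupType) (O : operad G) :
  is_opmap (SeqMap (to_terminal_seqmap O)).
Proof. by []. Qed.

Definition to_terminal (G : finGroupType) (O : operad G) :
  opmap O (terminal_obj G) := OpMap (to_terminal_opmap O).

(** Evaluating at the tuple [(0, ..., n - 1)] of distinct numbers, injectivity of [x] equates this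
    tuple with its permutation by [s]. *)
Lemma inj_obj_free (G : finGroupType) n (x : inj_obj G n) (s : 'S_n) :
  sact x s = x -> s = 1.
Proof.
move=> /(congr1 sval) e; apply/permP=> i; rewrite perm1.
have x_inj : injective (sval x) := proj2_sig x.
apply: val_inj; pose v (l : 'I_n) : nat := l.
have /x_inj : sval x (fun l => v (s l)) = sval x v := congr1 (@^~ v) e.
exact: (congr1 (@^~ i)).
Qed.

(** Over a trivial group every graph subgroup is trivial, so any operation is fixed and it suffices
    that each arity is inhabited. *)
Lemma inj_obj_fixed_surj (G : finGroupType) : (forall g : G, g = 1) ->
  fixed_surj (to_terminal (inj_obj G)).
Proof.
move=> G1 n K /graph_subgroupP graphK [] _; exists (inj_op n) => // -[g s].
rewrite (G1 g) => /graphK ->; exact: prodact1.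
Qed.

(** * The regular representation *)

Section Regular.
Variable G : finGroupType.

(** Right rather than left translation, because the product of permutations is
    [(s * t) i = t (s i)]. *)
Definition regular_perm (g : G) : 'S_#|G| :=
  perm (inj_comp (@enum_rank_inj G) (inj_comp (mulIg g) (@enum_val_inj _ _))).

Lemma regular_permE g i : regular_perm g i = enum_rank (enum_val i * g).
Proof. by rewrite permE. Qed.

Lemma regular_permM : {in [set: G] &, {morph regular_perm : g h / g * h}}.
Proof.
move=> g h _ _; apply/permP=> i.
by rewrite permM !regular_permE enum_rankK mulgA.
Qed.

Lemma regular_perm_eq1 g : regular_perm g = 1 -> g = 1.
Proof.
move=> /permP/(_ (enum_rank 1)).
by rewrite regular_permE perm1 enum_rankK mul1g => /enum_rank_inj.
Qed.

Lemma regular_graph_group_set :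
  group_set [set ((g, regular_perm g) : GSym G #|G|) | g in [set: G]%G].
Proof.
have reg1 : regular_perm 1 = 1 := morph1 (Morphism regular_permM).
apply/group_setP; split=> [|_ _ /imsetP[g _ ->] /imsetP[h _ ->]].
  by apply/imsetP; exists 1; rewrite ?inE ?reg1.
by apply/imsetP; exists (g * h); rewrite ?regular_permM ?inE.
Qed.

Lemma regular_graph_subgroup : graph_subgroup (Group regular_graph_group_set).
Proof. by exists [set: G]%G, (Morphism regular_permM). Qed.
End Regular.

Theorem proposition6p3 (G G' : finGroupType) (f : {morphism [set: G] >-> G'}) :
  Quillen_adjunction (op_model G') (op_model G) (res_coind_adjunction f) /\
  (Quillen_adjunction (op_model G) (op_model G') (ind_res_adjunction f) <->
   injective f).
Proof.
split; first exact/Quillen_fixed_surjP/coind_fixed_surj.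
split=> [/Quillen_fixed_surjP surj_res | inj_f]; last first.
  exact/Quillen_fixed_surjP/res_fixed_surj.
(* A trivial group, with its inclusion [c] into [G']; coinduction along [c] makes a [G']-operad out
   of a plain one. *)
pose T : finGroupType := subg_of (1%G : {group G'}).
have T1 (t : T) : t = 1 by apply: subg_inj; apply/set1P/subgP.
pose c : {morphism [set: T] >-> G'} := [morphism of sgval].
pose tt_fixed : coind c (terminal_obj T) #|G| :=
  @coind_const _ _ c (terminal_obj T) #|G| tt (fun=> erefl).
(* The coinduced map to the terminal operad is still surjective on fixed points; by assumption so is
   its restriction along [f], which must then hit the constant operation. *)
have [] := surj_res _ _ _ (coind_fixed_surj (inj_obj_fixed_surj T1) (f := c))
  _ _ (regular_graph_subgroup G) tt_fixed.
  by move=> a _; apply: coind_ops_eq => x; case: (sval _ x); case: (sval _ x).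
move=> phi Kphi _.
(* For [k] in the kernel, [(k, regular_perm k)] acts on [phi] through its permutation alone;
   freeness at the value of [phi] at 1 makes that permutation trivial. *)
have ker_f k : f k = 1 -> k = 1.
  move=> fk; apply: regular_perm_eq1; apply: invg_inj; rewrite invg1.
  apply: (inj_obj_free (x := sval phi 1)).
  have Kk : (k, regular_perm k) \in Group (regular_graph_group_set G).
    by apply/imsetP; exists k; rewrite ?inE.
  by have := congr1 (fun psi => sval psi 1) (Kphi _ Kk); rewrite /= fk mulg1.
move=> g h e; apply/eqP; rewrite eq_mulVg1; apply/eqP/ker_f.
by rewrite morphM ?morphV ?inE // e mulVg.
Qed.
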